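(* Algorithm Online_SumCj (described in the context) is 2-competitive for the online problem $1|jrp,s=1,p_j=1,r_j|\sum C_j+c_\mathcal{Q}$; that is, on every instance the cost of the solution it produces is at most twice the optimal offline cost.
   Context: Problem $1|jrp,s=1,p_j=1,r_j|\sum C_j+c_\mathcal{Q}$: jobs with processing time $1$ and nonnegative integer release dates $r_j$ must be processed non-preemptively on a single machine (at most one job at a time). There is a single resource, required by every job; each replenishment of it costs $K:=K_0+K_1\ge0$. A solution consists of start times $S_j$ (completion times $C_j=S_j+1$) and replenishment times $t_1<\dots<t_q$; it is feasible if no two jobs overlap and for each job $j$ some replenishment time lies in $[r_j,S_j]$. Its cost is $\sum_jC_j+qK$. Online setting: jobs are not known in advance (neither their number nor their data); a job becomes known at its release date. Time proceeds in integer steps; at each time $t$ the algorithm first learns the jobs released at $t$, then decides whether to replenish at $t$, then may start jobs; decisions cannot be revoked. An online algorithm is $c$-competitive if on every instance its cost is at most $c$ times the optimal offline cost. Let $G(a)=a(a+1)/2$. Algorithm Online_SumCj: start with $t:=0$. Repeat: let $B_t$ be the set of jobs released by time $t$ that are not yet scheduled; if $t\cdot|B_t|+G(|B_t|)\ge K$, then replenish the resource at $t$, start the jobs of $B_t$ consecutively from time $t$ without idle time in increasing release date order, and set $t:=t+|B_t|$; otherwise set $t:=t+1$.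
   Formalization: The algorithm replenishes at t only if B_t is nonempty; this is automatic for K > 0, but for K = 0 the literal loop would replenish with B_t empty, set t := t + 0 and never advance, producing no solution. *)

(* Defs.v *)
From mathcomp Require Import all_boot all_order all_algebra.
From mathcomp Require Import classical_sets reals.

Set Implicit Arguments.
Unset Strict Implicit.
Unset Printing Implicit Defensive.

Import Order.TTheory GRing.Theory Num.Theory.
Local Open Scope ring_scope.

(* [repl_cost] is K = K_0 + K_1; only the sum enters the problem. *)
Record instance (R : realType) := Instance {
  njobs : nat;
  release : 'I_njobs -> nat;
  repl_cost : R;
  repl_cost_ge0 : 0 <= repl_cost }.

Notation job I := 'I_(njobs I).

(* Offline solutions may use arbitrary real times. *)
Record solution (R : realType) (I : instance R) := Solution {
  start : job I -> R;
  repl_times : seq R }.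

Definition feasible (R : realType) (I : instance R) (s : solution I) : Prop :=
  [/\ sorted <%R (repl_times s),
      forall i j : job I, i != j ->
        start s i + 1 <= start s j \/ start s j + 1 <= start s i
    & forall j : job I, exists2 t : R, t \in repl_times s
        & (release j)%:R <= t <= start s j].

Definition cost (R : realType) (I : instance R) (s : solution I) : R :=
  \sum_(j : job I) (start s j + 1)
  + (size (repl_times s))%:R * repl_cost I.

Definition opt_cost (R : realType) (I : instance R) : R :=
  inf [set cost s | s in [set s : solution I | feasible s]]%classic.

(* An algorithm is given by the relation "on instance I it produces s". *)
Definition competitive (R : realType) (c : R)
    (alg : forall I : instance R, solution I -> Prop) : Prop :=
  forall I : instance R,
    (exists s, alg I s) /\
    (forall s, alg I s -> feasible s /\ cost s <= c * opt_cost I).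

Definition G (R : realType) (a : nat) : R := a%:R * (a%:R + 1) / 2.

Record state (R : realType) (I : instance R) := State {
  now : nat;
  started : job I -> option nat;
  repls : seq nat }.

Definition init (R : realType) (I : instance R) : state I :=
  @State R I 0%N (fun=> None) [::].

(* The set B_t for t = now st. *)
Definition pending (R : realType) (I : instance R) (st : state I) :
    {set job I} :=
  [set j : job I | (release j <= now st)%N && (started st j == None)].

(* The order in which the jobs of a batch are started: by nondecreasing release
   date, ties being broken arbitrarily. *)
Definition release_order (R : realType) (I : instance R)
    (ord : {set job I} -> seq (job I)) : Prop :=
  forall B : {set job I},
    perm_eq (ord B) (enum B) /\
    sorted (fun i j : job I => (release i <= release j)%N) (ord B).

(* The test [0 < #|B|] follows from the other one when K > 0; for K = 0 it
   prevents the loop from replenishing forever at the same t with B_t empty. *)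
Definition step (R : realType) (I : instance R)
    (ord : {set job I} -> seq (job I)) (st : state I) : state I :=
  let t := now st in
  let B := pending st in
  if (0 < #|B|)%N && (repl_cost I <= t%:R * #|B|%:R + G R #|B|) then
    State (t + #|B|)%N
      (fun j => if j \in B then Some (t + index j (ord B))%N else started st j)
      (rcons (repls st) t)
  else State t.+1 (started st) (repls st).

Definition run (R : realType) (I : instance R)
    (ord : {set job I} -> seq (job I)) (k : nat) : state I :=
  iter k (step ord) (init I).

(* Once every job has been started, further iterations change only [now]. *)
Definition Online_SumCj (R : realType)
    (ord : forall I : instance R, {set job I} -> seq (job I))
    (I : instance R) (s : solution I) : Prop :=
  exists k : nat,
    [/\ forall j : job I, exists2 m : nat,
          started (run (ord I) k) j = Some m & start s j = m%:R
      & repl_times s = [seq t%:R | t <- repls (run (ord I) k)]].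

(* Main.v *)
Require Import Defs.
From mathcomp Require Import classical_sets reals.
From mathcomp Require Import all_boot all_order all_algebra.
From mathcomp Require Import ring lra.

(** Fix a feasible solution [s].  Every batch of the algorithm has total
    completion time at least [K].  Call a batch started at [t] late if none of
    its jobs starts before [t] in [s]; otherwise [s] replenishes after the
    previous replenishment of the algorithm and before [t], and this [K] is
    charged to the batch.  Split a maximal period in which the machine is busy
    at its first late batch.  From that batch on the algorithm is optimal for
    the sum of completion times, hence its cost is at most twice that of [s].
    The batches before it, started at [a], behave like one batch of [m + n]
    jobs, [m] of which were already pending at [a - 1]: since the algorithm
    waited at [a - 1], the excess of its completion times over twice those of
    [s] is at most [K].  The proof carries this accounting along the run of
    the algorithm as an invariant. *)

Set Implicit Arguments.
Unset Strict Implicit.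
Unset Printing Implicit Defensive.

Import Order.TTheory GRing.Theory Num.Theory.
Local Open Scope ring_scope.

(** * Completion times of consecutive unit jobs *)

(** The start [a] is real so that [a - 1] makes sense also at [a = 0]. *)
Definition batch_cost (R : realType) (a : R) (n : nat) : R := a * n%:R + G R n.

Lemma batch_cost0 (R : realType) (a : R) : batch_cost a 0 = 0.
Proof. by rewrite /batch_cost /G mulr0 mul0r mul0r addr0. Qed.

Lemma batch_costD (R : realType) (a : R) (m n : nat) :
  batch_cost a (m + n) = batch_cost a m + batch_cost (a + m%:R) n.
Proof. by rewrite /batch_cost /G natrD; field. Qed.

Lemma batch_cost_sum (R : realType) (a : R) (n : nat) :
  batch_cost a n = \sum_(0 <= i < n) (a + i%:R + 1).
Proof.
elim: n => [|n IHn]; first by rewrite big_geq // batch_cost0.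
by rewrite big_nat_recr //= -IHn -addn1 batch_costD /batch_cost /G; field.
Qed.

(** Induction on [#|A|]: remove the job that starts first; all others start at least one unit
    later. *)
Lemma batch_cost_le_completions (R : realType) (T : finType) (S : T -> R)
    (A : {set T}) (a : R) :
  (forall i j, i != j -> S i + 1 <= S j \/ S j + 1 <= S i) ->
  {in A, forall j, a <= S j} ->
  batch_cost a #|A| <= \sum_(j in A) (S j + 1).
Proof.
move=> sepS; move: {2}#|A| (erefl #|A|) => n.
elim: n A a => [|n IHn] A a cardA leaS.
  move/eqP: (cardA); rewrite cards_eq0 => /eqP ->.
  by rewrite cards0 big_set0 batch_cost0.
have /card_gt0P[j0 j0A] : (0 < #|A|)%N by rewrite cardA.
case: (arg_minP S j0A) => j /= jA' minj; have {jA'}jA : j \in A by [].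
have cardAj : #|A :\ j| = n by have := cardsD1 j A; rewrite jA cardA => -[].
rewrite (big_setD1 j) //=.
have {}IHn : batch_cost (a + 1) n <= \sum_(i in A :\ j) (S i + 1).
  rewrite -cardAj; apply: IHn => // i; rewrite !inE => /andP[neq_ij iA].
  have := leaS j jA; have := minj i iA.
  by case: (sepS i j neq_ij) => *; lra.
have := leaS j jA; rewrite cardA -add1n batch_costD {1}/batch_cost /G; lra.
Qed.

(** Replacing [K] by its lower bound, the right side exceeds the left by
    [a n + n/2 + (n - m)^2/2 + m^2/2]. *)
Lemma waiting_batch_bound (R : realType) (K a : R) (m n : nat) :
  0 <= a -> batch_cost (a - 1) m <= K ->
  batch_cost a (m + n) <= 2 * (batch_cost 0 m + batch_cost a n) + K.
Proof.
rewrite /batch_cost /G natrD => a0 leK.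
have m0 : 0 <= m%:R :> R by [].
have n0 : 0 <= n%:R :> R by [].
have an0 : 0 <= a * n%:R by rewrite mulr_ge0.
have := sqr_ge0 (n%:R - m%:R : R); have := sqr_ge0 (m%:R : R).
by move: leK; rewrite !expr2; nra.
Qed.

Lemma sum_index (R : nmodType) (T : finType) (A : {set T}) (s : seq T)
    (F : nat -> R) :
  perm_eq s (enum A) ->
  \sum_(j in A) F (index j s) = \sum_(0 <= i < #|A|) F i.
Proof.
move=> sA; rewrite -big_enum /= -(perm_big _ sA) /= cardE -(perm_size sA).
have us : uniq s by rewrite (perm_uniq sA) enum_uniq.
case: s sA us => [|x s] _ us; first by rewrite !big_nil.
rewrite (big_nth x) big_nat [RHS]big_nat; apply: eq_bigr => i /andP[_ lti].
by rewrite index_uniq.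
Qed.

(** * States of the algorithm and their invariants *)

Definition served (R : realType) (I : instance R) (st : state I) :
    {set job I} := [set j | started st j != None].

Definition served_at (R : realType) (I : instance R) (st : state I)
    (j : job I) : nat := odflt 0%N (started st j).

Definition alg_cost (R : realType) (I : instance R) (st : state I) : R :=
  \sum_(j in served st) ((served_at st j)%:R + 1)
  + (size (repls st))%:R * repl_cost I.

Definition fires (R : realType) (I : instance R) (st : state I) : bool :=
  (0 < #|pending st|)%N
  && (repl_cost I <= batch_cost (now st)%:R #|pending st|).

Definition serve (R : realType) (I : instance R)
    (ord : {set job I} -> seq (job I)) (st : state I) : state I :=
  State (now st + #|pending st|)%N
    (fun j => if j \in pending st
              then Some (now st + index j (ord (pending st)))%N
              else started st j)
    (rcons (repls st) (now st)).

Lemma stepE (R : realType) (I : instance R) (ord : {set job I} -> seq (job I))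
    (st : state I) :
  step ord st = if fires st then serve ord st
                else State (now st).+1 (started st) (repls st).
Proof. by []. Qed.

Lemma not_fires_le (R : realType) (I : instance R) (st : state I) :
  ~~ fires st -> batch_cost (now st)%:R #|pending st| <= repl_cost I.
Proof.
rewrite negb_and -leqNgt leqn0 -ltNge => /orP[/eqP ->|/ltW //].
by rewrite batch_cost0 repl_cost_ge0.
Qed.

Lemma served_serve (R : realType) (I : instance R)
    (ord : {set job I} -> seq (job I)) (st : state I) :
  served (serve ord st) = served st :|: pending st.
Proof.
apply/setP => j; rewrite in_setU !in_set /=.
by case: ifP; rewrite inE => ->; rewrite ?orbT ?orbF.
Qed.

Lemma served_pending_disjoint (R : realType) (I : instance R) (st : state I) :
  [disjoint served st & pending st].
Proof.
rewrite -setI_eq0; apply/eqP/setP => j; rewrite !inE.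
by case: eqP; rewrite ?andbF.
Qed.

Lemma sum_disjointU (R : nmodType) (T : finType) (A B : {set T})
    (F : T -> R) :
  [disjoint A & B] ->
  \sum_(j in A :|: B) F j = \sum_(j in A) F j + \sum_(j in B) F j.
Proof.
by move=> dAB; rewrite -bigU //; apply: eq_bigl => j; rewrite !inE.
Qed.

Lemma card_disjointU (T : finType) (A B : {set T}) :
  [disjoint A & B] -> #|A :|: B| = (#|A| + #|B|)%N.
Proof. by move=> /disjoint_setI0 AB0; rewrite cardsU AB0 cards0 subn0. Qed.

Lemma alg_cost_serve (R : realType) (I : instance R)
    (ord : {set job I} -> seq (job I)) (st : state I) :
  release_order ord ->
  alg_cost (serve ord st)
  = alg_cost st + batch_cost (now st)%:R #|pending st| + repl_cost I.
Proof.
move=> ordP; rewrite /alg_cost served_serve.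
rewrite sum_disjointU ?served_pending_disjoint //= size_rcons.
have -> : \sum_(j in served st) ((served_at (serve ord st) j)%:R + 1)
          = \sum_(j in served st) ((served_at st j)%:R + 1) :> R.
  apply: eq_bigr => j js; rewrite /served_at /=.
  by rewrite (disjointFr (served_pending_disjoint st) js).
have -> : \sum_(j in pending st) ((served_at (serve ord st) j)%:R + 1)
          = batch_cost (now st)%:R #|pending st| :> R.
  rewrite batch_cost_sum -(sum_index _ (proj1 (ordP (pending st)))).
  by apply: eq_bigr => j jB; rewrite /served_at /= jB /= natrD.
by rewrite -natr1 mulrDl mul1r; ring.
Qed.

(* One more than the last replenishment time: jobs not yet started are released
   at [horizon st] or later. *)
Definition horizon (R : realType) (I : instance R) (st : state I) : nat :=
  last 0%N [seq t.+1 | t <- repls st].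

Lemma horizon_serve (R : realType) (I : instance R)
    (ord : {set job I} -> seq (job I)) (st : state I) :
  horizon (serve ord st) = (now st).+1.
Proof. by rewrite /horizon /= map_rcons last_rcons. Qed.

(** The order of replenishments and the last two clauses yield feasibility; the bounds on [horizon]
    serve the charging argument. *)
Definition valid_state (R : realType) (I : instance R) (st : state I) : Prop :=
  [/\ sorted ltn (repls st), (horizon st <= now st)%N,
      forall j, started st j = None -> (horizon st <= release j)%N,
      forall j m, started st j = Some m ->
        (m < now st)%N /\
        exists2 t, t \in repls st & (release j <= t <= m)%N
    & forall i j m, i != j -> started st i = Some m -> started st j <> Some m].

Lemma valid_step (R : realType) (I : instance R)
    (ord : {set job I} -> seq (job I)) (st : state I) :
  release_order ord -> valid_state st -> valid_state (step ord st).
Proof.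
move=> ordP [srt hor unst stt inj]; rewrite stepE; case: ifP => [/andP[B0 _]|_].
  have indexB j : j \in pending st ->
      (index j (ord (pending st)) < #|pending st|)%N.
    have [permB _] := ordP (pending st).
    by rewrite cardE -(perm_size permB) index_mem (perm_mem permB) mem_enum.
  split.
  - move: srt hor; rewrite /horizon /=.
    case: (repls st) => //= x s; rewrite rcons_path last_map => -> /= hor.
    exact: hor.
  - by rewrite horizon_serve /= -addn1 leq_add2l.
  - move=> j; rewrite horizon_serve /=; case: ifP => // + stj.
    by rewrite inE stj eqxx andbT => /negbT; rewrite -ltnNge.
  - move=> j m /=; case: ifP => [jB [<-]|_ /stt[ltm [t ts rtm]]].
      split; first by rewrite ltn_add2l indexB.
      exists (now st); first by rewrite mem_rcons mem_head.
      by rewrite leq_addr andbT; move: jB; rewrite inE => /andP[].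
    split; first by rewrite ltn_addr.
    by exists t => //; rewrite mem_rcons in_cons ts orbT.
  (* Within the batch, positions in [ord] differ; an older job started before [now st], a new one
     does not. *)
  - move=> i j m neq_ij /=; case: ifP => [iB [<-]|iB sti]; case: ifP => jB.
    + move=> [] /addnI /esym eq_idx; case/eqP: neq_ij.
      have [permB _] := ordP (pending st).
      by apply: (index_inj i _ _ eq_idx);
        rewrite (perm_mem permB) mem_enum.
    + by move=> /stt[]; rewrite ltnNge leq_addr.
    + by move=> [] eqm; have [] := stt _ _ sti; rewrite -eqm ltnNge leq_addr.
    + exact: inj sti.
split => //=; first exact: leqW.
by move=> j m /stt[ltm ?]; split => //; apply: leqW.
Qed.

Lemma valid_run (R : realType) (I : instance R)
    (ord : {set job I} -> seq (job I)) (k : nat) :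
  release_order ord -> valid_state (run ord k).
Proof.
by move=> ordP; elim: k => // k IHk; apply: valid_step.
Qed.

(** * The account between the algorithm and [s] *)

Definition completions (R : realType) (I : instance R) (s : solution I)
    (A : {set job I}) : R := \sum_(j in A) (start s j + 1).

Lemma completionsU (R : realType) (I : instance R) (s : solution I)
    (A B : {set job I}) :
  [disjoint A & B] ->
  completions s (A :|: B) = completions s A + completions s B.
Proof. exact: sum_disjointU. Qed.

(** With this cutoff, a replenishment of [s] that serves a job not yet started by the algorithm is
    not counted before that job's batch. *)
Definition past_repls (R : realType) (I : instance R) (s : solution I)
    (st : state I) : nat :=
  count (fun t => t < (horizon st)%:R) (repl_times s).

(** The potential of the analysis. If it is nonnegative, the ratio 2 follows, as the remaining jobs
    and replenishments only add to the cost of [s]. *)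
Definition slack (R : realType) (I : instance R) (s : solution I)
    (st : state I) : R :=
  2 * completions s (served st) + 2 * (past_repls s st)%:R * repl_cost I
  - alg_cost st.

Lemma past_repls_le (R : realType) (I : instance R) (s : solution I)
    (st st' : state I) :
  (horizon st <= horizon st')%N -> (past_repls s st <= past_repls s st')%N.
Proof.
move=> lehh; apply: sub_count => t /= /lt_le_trans; apply.
by rewrite ler_nat.
Qed.

Lemma past_repls_lt (R : realType) (I : instance R) (s : solution I)
    (st st' : state I) (t : R) :
  t \in repl_times s -> (horizon st)%:R <= t < (horizon st')%:R ->
  (past_repls s st < past_repls s st')%N.
Proof.
move=> ts /andP[leht ltht].
have hh : (horizon st)%:R <= (horizon st')%:R :> R.
  exact: ltW (le_lt_trans leht ltht).
rewrite /past_repls; elim: (repl_times s) ts => //= x T IHT.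
have leT : (count (fun t => (t < (horizon st)%:R)%R) T
            <= count (fun t => (t < (horizon st')%:R)%R) T)%N.
  by apply: sub_count => y /= /lt_le_trans; apply.
rewrite in_cons => /predU1P[<-|/IHT ltT].
  by rewrite ltht ltNge leht /= add0n add1n ltnS.
rewrite -addnS leq_add //.
case: (ltP x (horizon st)%:R) => // ltx.
by rewrite (lt_le_trans ltx hh).
Qed.

Lemma slack_serve (R : realType) (I : instance R) (s : solution I)
    (ord : {set job I} -> seq (job I)) (st : state I) :
  release_order ord ->
  slack s (serve ord st)
  = slack s st + 2 * completions s (pending st)
    + 2 * ((past_repls s (serve ord st))%:R - (past_repls s st)%:R)
        * repl_cost I
    - batch_cost (now st)%:R #|pending st| - repl_cost I.
Proof.
move=> ordP; rewrite /slack alg_cost_serve // served_serve.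
by rewrite completionsU ?served_pending_disjoint //; ring.
Qed.

(** * The three modes of the invariant *)

(* From [a] on the machine has been busy, exactly with the jobs of
   [E], and none of them starts before [a] in [s], so the batches since [a]
   have the least possible total completion time. *)
Definition late_busy (R : realType) (I : instance R) (s : solution I)
    (st : state I) : Prop :=
  exists a : nat, exists E : {set job I},
    [/\ E \subset served st, {in E, forall j, a%:R <= start s j},
        now st = (a + #|E|)%N, (a <= horizon st)%N
      & 2 * completions s E - 2 * batch_cost a%:R #|E| <= slack s st].

(* From [a] on the machine has been busy, exactly with the jobs of
   [W :|: E], and [s] has replenished once for each batch since then; the jobs
   of [W] were released before [a], when the machine was waiting. *)
Definition early_busy (R : realType) (I : instance R) (s : solution I)
    (st : state I) : Prop :=
  exists a : nat, exists W E : {set job I},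
    [/\ W :|: E \subset served st /\ [disjoint W & E],
        {in E, forall j, a%:R <= start s j},
        batch_cost (a%:R - 1) #|W| <= repl_cost I,
        now st = (a + #|W :|: E|)%N /\ (a <= horizon st)%N
      & 2 * completions s (W :|: E) + repl_cost I
          - batch_cost a%:R #|W :|: E| <= slack s st].

(** The second clause records the failed test one time unit earlier; at time 0 its set is empty. *)
Definition waiting (R : realType) (I : instance R) (s : solution I)
    (st : state I) : Prop :=
  0 <= slack s st /\
  batch_cost ((now st)%:R - 1)
    #|[set j | (release j < now st)%N && (started st j == None)]|
    <= repl_cost I.

Lemma slack_late_busy (R : realType) (I : instance R) (s : solution I)
    (st : state I) :
  feasible s -> late_busy s st -> 0 <= slack s st.
Proof.
move=> [_ sep _] [a [E [_ leE _ _]]].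
by have := batch_cost_le_completions sep leE; rewrite -/(completions s E); lra.
Qed.

Lemma start_ge_release (R : realType) (I : instance R) (s : solution I)
    (j : job I) : feasible s -> (release j)%:R <= start s j.
Proof. by move=> [_ _ /(_ j)[t _ /andP[]]]; apply: le_trans. Qed.

(** In [s] the jobs of [W] start at 0 or later and those of [E] at [a] or later. Bounding the two
    sums separately leaves exactly [waiting_batch_bound]. *)
Lemma slack_early_busy (R : realType) (I : instance R) (s : solution I)
    (st : state I) :
  feasible s -> early_busy s st -> 0 <= slack s st.
Proof.
move=> fs; have [_ sep _] := fs; move=> [a [W [E [[_ dWE] leE leK _]]]].
have leW : {in W, forall j, 0 <= start s j}.
  by move=> j _; apply: le_trans (start_ge_release j fs); rewrite ler0n.
have := waiting_batch_bound #|E| (ler0n R a) leK.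
have := batch_cost_le_completions sep leE.
have := batch_cost_le_completions sep leW.
rewrite card_disjointU // completionsU // -!/(completions s _); lra.
Qed.

(** * Effect of serving a batch on the account *)

Lemma repl_credit_ge0 (R : realType) (I : instance R) (s : solution I)
    (ord : {set job I} -> seq (job I)) (st : state I) :
  valid_state st ->
  0 <= ((past_repls s (serve ord st))%:R - (past_repls s st)%:R) * repl_cost I.
Proof.
move=> [_ hor _ _ _]; rewrite mulr_ge0 ?repl_cost_ge0 // subr_ge0 ler_nat.
by apply: past_repls_le; rewrite horizon_serve leqW.
Qed.

(** The replenishment of [s] for [j] lies between the release of [j], hence the old horizon, and
    [now st], so it is newly counted. *)
Lemma early_repl_credit (R : realType) (I : instance R) (s : solution I)
    (ord : {set job I} -> seq (job I)) (st : state I) (j : job I) :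
  feasible s -> valid_state st -> j \in pending st ->
  start s j < (now st)%:R ->
  repl_cost I
  <= ((past_repls s (serve ord st))%:R - (past_repls s st)%:R) * repl_cost I.
Proof.
move=> [_ _ /(_ j)[t ts /andP[rt tS]]] [_ _ unst _ _] + early.
rewrite inE => /andP[_ /eqP/unst hr].
rewrite ler_peMl ?repl_cost_ge0 // lerBrDl natr1 ler_nat.
apply: (past_repls_lt ts); rewrite horizon_serve.
rewrite (le_trans _ rt) ?ler_nat //=.
by apply: le_lt_trans tS (lt_trans early _); rewrite ltr_nat.
Qed.

(** The firing test bounds [K] by the completion times of the batch, so the batch costs at most
    twice these and needs no credit from replenishments of [s]. *)
Lemma serve_late (R : realType) (I : instance R) (s : solution I)
    (ord : {set job I} -> seq (job I)) (st : state I) :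
  release_order ord -> valid_state st -> fires st -> 0 <= slack s st ->
  {in pending st, forall j, (now st)%:R <= start s j} ->
  late_busy s (serve ord st).
Proof.
move=> ordP vst /andP[_ leK] sl lateB.
exists (now st), (pending st); split => //.
- by rewrite served_serve subsetUr.
- by rewrite horizon_serve.
- rewrite slack_serve //.
  by have := repl_credit_ge0 s ord vst; lra.
Qed.

Lemma pending_ge_horizon (R : realType) (I : instance R) (st : state I)
    (s : solution I) (a : nat) :
  feasible s -> valid_state st -> (a <= horizon st)%N ->
  {in pending st, forall j, a%:R <= start s j}.
Proof.
move=> fs [_ _ unst _ _] lea j; rewrite inE => /andP[_ /eqP/unst hr].
by apply: le_trans (start_ge_release j fs); rewrite ler_nat (leq_trans lea).
Qed.

(** The batch itself need not be late: its jobs are released at the horizon or later, hence not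
    before [a]. *)
Lemma serve_late_busy (R : realType) (I : instance R) (s : solution I)
    (ord : {set job I} -> seq (job I)) (st : state I) :
  release_order ord -> feasible s -> valid_state st -> fires st ->
  late_busy s st -> late_busy s (serve ord st).
Proof.
move=> ordP fs vst /andP[_ leK] [a [E [subE leE nowE lea sl]]].
have [_ hor _ _ _] := vst.
have dEB : [disjoint E & pending st].
  exact: disjointWl subE (served_pending_disjoint st).
exists a, (E :|: pending st); split.
- by rewrite served_serve setSU.
- move=> j; rewrite in_setU => /orP[/leE //|].
  exact: pending_ge_horizon.
- by rewrite card_disjointU //= nowE addnA.
- by rewrite horizon_serve (leq_trans lea) // leqW.
- rewrite slack_serve // card_disjointU // batch_costD -natrD -nowE.
  have := repl_credit_ge0 s ord vst.
  by rewrite completionsU //; lra.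
Qed.

(** The newly counted replenishment of [s] is worth [2 K], which covers the [K] of this batch. *)
Lemma serve_early_busy (R : realType) (I : instance R) (s : solution I)
    (ord : {set job I} -> seq (job I)) (st : state I) (j : job I) :
  release_order ord -> feasible s -> valid_state st ->
  j \in pending st -> start s j < (now st)%:R ->
  early_busy s st -> early_busy s (serve ord st).
Proof.
move=> ordP fs vst jB early [a [W [E [[subE dWE] leE leK [nowE lea] sl]]]].
have [_ hor _ _ _] := vst.
have dB : [disjoint W :|: E & pending st].
  exact: disjointWl subE (served_pending_disjoint st).
exists a, W, (E :|: pending st); rewrite setUA; split => //.
- split; first by rewrite served_serve setSU.
  rewrite -setI_eq0 setIUr !disjoint_setI0 ?setU0 //.
  exact: disjointWl (subsetUl W E) dB.
- move=> i; rewrite in_setU => /orP[/leE //|].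
  exact: pending_ge_horizon.
- rewrite card_disjointU //= nowE addnA; split=> //.
  by rewrite horizon_serve (leq_trans lea) // leqW.
- rewrite slack_serve // [#|_ :|: pending _|]card_disjointU // batch_costD.
  rewrite -natrD -nowE.
  have := early_repl_credit ord fs vst jB early.
  have := repl_cost_ge0 I.
  by rewrite [completions s (_ :|: pending st)]completionsU //; lra.
Qed.

(** The term [K] in [early_busy] arises here: a credit of [2 K] less the replenishment of the batch.
    Pending jobs outside [W] are released exactly at [now st]. *)
Lemma serve_waiting (R : realType) (I : instance R) (s : solution I)
    (ord : {set job I} -> seq (job I)) (st : state I) (j : job I) :
  release_order ord -> feasible s -> valid_state st ->
  j \in pending st -> start s j < (now st)%:R ->
  waiting s st -> early_busy s (serve ord st).
Proof.
move=> ordP fs vst jB early [sl].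
set W := [set _ | _]; move=> leK.
have subW : W \subset pending st.
  by apply/subsetP => i; rewrite !inE => /andP[/ltnW -> ->].
have WE : W :|: (pending st :\: W) = pending st.
  by rewrite setDE setUIr setUCr setIT; apply/setUidPr.
exists (now st), W, (pending st :\: W); rewrite WE; split => //.
- split; first by rewrite served_serve subsetUr.
  by rewrite -setI_eq0 setDE setICA setICr setI0.
- move=> i; rewrite !inE => /andP[+ /andP[_ sti]].
  rewrite sti andbT -leqNgt => ler.
  by apply: le_trans (start_ge_release i fs); rewrite ler_nat.
- by rewrite horizon_serve leqnSn.
- rewrite slack_serve //.
  by have := early_repl_credit ord fs vst jB early; lra.
Qed.

(** * The invariant along the run *)

Definition amortized (R : realType) (I : instance R) (s : solution I)
    (st : state I) : Prop :=
  [\/ waiting s st, early_busy s st | late_busy s st].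

Lemma slack_amortized (R : realType) (I : instance R) (s : solution I)
    (st : state I) :
  feasible s -> amortized s st -> 0 <= slack s st.
Proof.
move=> fs [[] //| |]; [exact: slack_early_busy|exact: slack_late_busy].
Qed.

Lemma amortized_init (R : realType) (I : instance R) (s : solution I) :
  amortized s (init I).
Proof.
constructor 1; split.
  rewrite /slack /alg_cost /completions.
  have -> : served (init I) = set0 by apply/setP => j; rewrite !inE.
  rewrite !big_set0 /= mulr0 mul0r addr0 subr0 add0r.
  by rewrite !mulr_ge0 ?repl_cost_ge0.
by rewrite (_ : [set _ | _] = set0) ?cards0 ?batch_cost0 ?repl_cost_ge0 //.
Qed.

Lemma amortized_step (R : realType) (I : instance R) (s : solution I)
    (ord : {set job I} -> seq (job I)) (st : state I) :
  release_order ord -> feasible s -> valid_state st ->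
  amortized s st -> amortized s (step ord st).
Proof.
move=> ordP fs vst amst; have sl := slack_amortized fs amst.
rewrite stepE; case: (boolP (fires st)) => [fst|/not_fires_le leK].
  have [/existsP[j /andP[jB early]]|] :=
    boolP [exists j, (j \in pending st) && (start s j < (now st)%:R)].
    case: amst => mode.
    - by constructor 2; apply: (serve_waiting ordP fs vst jB early).
    - by constructor 2; apply: (serve_early_busy ordP fs vst jB early).
    - by constructor 3; apply: serve_late_busy.
  (* Without an early job, a late period starts afresh in any mode, as only [0 <= slack] is
     required. *)
  rewrite negb_exists => /forallP late; constructor 3; apply: serve_late => //.
  by move=> j jB; move: (late j); rewrite jB /= -leNgt.
(* Not firing leads from any mode to [waiting]: the test that failed at [t] is the bound required at
   [t + 1]. *)
constructor 1; split => //=.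
by rewrite -natr1 addrK.
Qed.

Lemma slack_run_ge0 (R : realType) (I : instance R) (s : solution I)
    (ord : {set job I} -> seq (job I)) (k : nat) :
  release_order ord -> feasible s -> 0 <= slack s (run ord k).
Proof.
move=> ordP fs; apply: slack_amortized => //.
elim: k => [|k IHk]; first exact: amortized_init.
by apply: amortized_step => //; apply: valid_run.
Qed.

Lemma alg_cost_le (R : realType) (I : instance R) (s : solution I)
    (ord : {set job I} -> seq (job I)) (k : nat) :
  release_order ord -> feasible s -> alg_cost (run ord k) <= 2 * cost s.
Proof.
move=> ordP fs; have := slack_run_ge0 k ordP fs.
set st := run ord k; rewrite /slack subr_ge0 => /le_trans; apply.
rewrite /cost mulrDr -mulrA lerD // ler_pM2l //.
  rewrite /completions [leRHS](bigID (mem (served st))) /= lerDl sumr_ge0 //.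
  by move=> j _; rewrite addr_ge0 // (le_trans _ (start_ge_release j fs)).
by rewrite ler_wpM2r ?repl_cost_ge0 // ler_nat count_size.
Qed.

(** * Termination, feasibility and the ratio *)

Lemma run_now_ge (R : realType) (I : instance R)
    (ord : {set job I} -> seq (job I)) (k : nat) : (k <= now (run ord k))%N.
Proof.
elim: k => //= k IHk; rewrite -/(run ord k) stepE.
by case: ifP => [/andP[B0 _]|//] /=; rewrite -[k.+1]addn1 leq_add.
Qed.

Lemma run_serves_all (R : realType) (I : instance R)
    (ord : {set job I} -> seq (job I)) :
  exists k, forall j, started (run ord k) j != None.
Proof.
have [n leKn] : exists n : nat, repl_cost I <= n%:R.
  by exists (Num.bound (repl_cost I)); apply/ltW/archi_boundP/repl_cost_ge0.
(* After [k] steps every job is released and the time is at least [n >= K], so any nonempty pending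
   set passes the test and is served in the next step. *)
pose k := (n + \max_j (@release R I) j)%N; exists k.+1 => j.
have := run_now_ge ord k; rewrite /= -/(run ord k); set st := run ord k => lek.
have released (i : job I) : (release i <= now st)%N.
  apply: leq_trans lek; apply: leq_trans (leq_addl n _).
  exact: leq_bigmax.
rewrite stepE; case: ifP => [_|] /=.
  case: ifP => //; rewrite inE released /= => /negbT //.
case stj: (started st j) => [//|].
have B0 : (0 < #|pending st|)%N.
  by apply/card_gt0P; exists j; rewrite inE released stj.
rewrite /fires B0 /=.
suff -> : repl_cost I <= batch_cost (now st)%:R #|pending st| by [].
apply: le_trans leKn _; apply: (@le_trans _ _ (now st)%:R).
  by rewrite ler_nat; apply: leq_trans lek; apply: leq_addr.
rewrite /batch_cost -[leLHS]addr0 lerD ?ler_peMr ?ler1n //.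
by rewrite /G divr_ge0 ?mulr_ge0 ?addr_ge0.
Qed.

Lemma Online_SumCj_feasible (R : realType)
    (ord : forall I : instance R, {set job I} -> seq (job I))
    (I : instance R) (s : solution I) :
  release_order (ord I) -> Online_SumCj ord s -> feasible s.
Proof.
move=> ordP [k [sts rps]]; have := valid_run k ordP.
move: sts rps; set st := run _ k => sts rps [srt _ _ stt inj]; split.
- rewrite rps sorted_map; apply: sub_sorted srt => m n /=.
  by rewrite ltr_nat.
- move=> i j neq_ij; have [m sti ->] := sts i; have [n stj ->] := sts j.
  rewrite !natr1 !ler_nat; apply/orP; rewrite -neq_ltn.
  by apply/eqP => eqmn; apply: (inj i j m neq_ij sti); rewrite stj eqmn.
- move=> j; have [m stj ->] := sts j.
  have [_ [t ts rtm]] := stt j m stj.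
  by exists t%:R; rewrite ?rps ?map_f // !ler_nat.
Qed.

Lemma Online_SumCj_cost (R : realType)
    (ord : forall I : instance R, {set job I} -> seq (job I))
    (I : instance R) (s : solution I) :
  Online_SumCj ord s -> exists k, cost s = alg_cost (run (ord I) k).
Proof.
move=> [k [sts rps]]; exists k; rewrite /cost /alg_cost rps size_map.
congr (_ + _); apply: eq_big => j.
  by rewrite inE; have [m ->] := sts j.
by move=> _; rewrite /served_at; have [m -> ->] := sts j.
Qed.

Theorem theorem10 (R : realType)
    (ord : forall I : instance R, {set job I} -> seq (job I))
    (ord_release : forall I : instance R, release_order (ord I)) :
  competitive 2 (Online_SumCj ord).
Proof.
move=> I; have ordP := ord_release I; split.
  have [k served_all] := run_serves_all (ord I); set st := run _ k in served_all.
  exists (@Solution R I (fun j => (served_at st j)%:R)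
            [seq t%:R | t <- repls st]).
  exists k; split => // j; have := served_all j; rewrite /= /served_at.
  by case stj: (started st j) => [m|//] _; exists m.
move=> s algs; have fs := Online_SumCj_feasible ordP algs; split => //.
(* [opt_cost] is an infimum, so half the cost is shown to be a lower bound over all feasible
   solutions; [s] itself shows that there is one. *)
rewrite mulrC -ler_pdivrMr //; apply: lb_le_inf; first by exists (cost s), s.
move=> _ [s' fs' <-]; have [k ->] := Online_SumCj_cost algs.
by rewrite ler_pdivrMr // mulrC alg_cost_le.
Qed.
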